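(* Let $r\geq1$ and let $\boldsymbol{\nu}=(\nu_0,\ldots,\nu_r)$ be a vector of pairwise distinct and pairwise coprime positive integers. For every $\mathbf{q}\in\mathbb{N}^{r+1}$ (positive integer entries) the series $\zeta_{\boldsymbol{\nu},\mathbf{q}}$ converges absolutely. Furthermore, for every $k$, $$Z_{k,\boldsymbol{\nu},\mathbf{q}}=\zeta_{\boldsymbol{\nu}^k,\mathbf{q}^k},$$ and $$\sum_{k:\,q_k=1}\nu_k\,Y_{k,\boldsymbol{\nu},\mathbf{q}} = -\sum_{k:\,q_k>1}\nu_k\,\zeta_{\boldsymbol{\nu},\mathbf{q}-\mathbf{e}_k}.$$
   Context: For $\mathbf{n}\in\mathbb{Z}^{r+1}$ and $\mathbf{m}\in\mathbb{Z}_{\ge0}^{r+1}$ set $\frac{1}{\mathbf{n}^{\mathbf{m}}}=\prod_j n_j^{-m_j}$ with conventions $0^0=1$, $0^{-m}=0$ for $m\ge1$. Let $\boldsymbol{\nu}^{\perp}_{\mathbb{Z}}=\{\mathbf{n}\in\mathbb{Z}^{r+1}:\sum_j\nu_jn_j=0\}$ and $\boldsymbol{\nu}^{\perp}_{\mathbb{Z}^\times}=\boldsymbol{\nu}^{\perp}_{\mathbb{Z}}\cap(\mathbb{Z}\setminus\{0\})^{r+1}$. Define $\zeta_{\boldsymbol{\nu},\mathbf{q}}:=\sum_{\mathbf{n}\in\boldsymbol{\nu}^{\perp}_{\mathbb{Z}^\times}}\frac{1}{\mathbf{n}^{\mathbf{q}}}$ (the same definition applies in any dimension). $\mathbf{q}_k$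 is $\mathbf{q}$ with $k$-th coordinate replaced by $0$; $\boldsymbol{\nu}^k$ and $\mathbf{q}^k$ are obtained from $\boldsymbol{\nu}$ and $\mathbf{q}$ by deleting the $k$-th coordinate; $\mathbf{e}_k$ is the $k$-th standard basis vector. Define $Z_{k,\boldsymbol{\nu},\mathbf{q}}:=\sum_{\mathbf{n}\in\boldsymbol{\nu}^{\perp}_{\mathbb{Z}},\,n_k=0}\frac{1}{\mathbf{n}^{\mathbf{q}_k}}$ and $Y_{k,\boldsymbol{\nu},\mathbf{q}}:=\sum_{\mathbf{n}\in\boldsymbol{\nu}^{\perp}_{\mathbb{Z}^\times}}\frac{1}{\mathbf{n}^{\mathbf{q}_k}}$. The individual series $Y_{k,\boldsymbol{\nu},\mathbf{q}}$ need not converge when some $q_j=1$, $j\neq k$; the left-hand side of the last identity is understood as the combined series $\sum_{\mathbf{n}\in\boldsymbol{\nu}^{\perp}_{\mathbb{Z}^\times}}\sum_{k:q_k=1}\nu_k\frac{1}{\mathbf{n}^{\mathbf{q}_k}}$. *)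

(* Defs.v *)
From HB Require Import structures.
From mathcomp Require Export all_boot all_order all_algebra.
From mathcomp Require Export all_classical all_reals ereal numfun esum.

Set Implicit Arguments.
Unset Strict Implicit.
Unset Printing Implicit Defensive.

Import Order.TTheory GRing.Theory Num.Theory.

Local Open Scope classical_set_scope.
Local Open Scope ring_scope.

(* In MathComp 0 ^+ 0 = 1 and 0^-1 = 0, so that 0 ^- 0 = 1 and 0 ^- m = 0 for
   m >= 1, which are the required conventions. *)
Definition inv_monomial (R : realType) (d : nat) (m : 'rV[nat]_d)
    (n : 'rV[int]_d) : R :=
  \prod_(j < d) (n ord0 j)%:~R ^- m ord0 j.

Definition perp (d : nat) (nu : 'rV[nat]_d) : set 'rV[int]_d :=
  [set n | \sum_(j < d) (nu ord0 j)%:Z * n ord0 j = 0].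

Definition perp_nz (d : nat) (nu : 'rV[nat]_d) : set 'rV[int]_d :=
  [set n | perp nu n /\ forall j : 'I_d, n ord0 j != 0].

Definition abs_summable (R : realType) (T : choiceType) (D : set T)
    (f : T -> R) : Prop :=
  summable D (EFin \o f).

(* The sum of f over D when f is absolutely summable on D (a junk value is
   returned otherwise): \esum is only meaningful for nonnegative terms, hence
   the splitting into positive and negative parts. *)
Definition abs_sum (R : realType) (T : choiceType) (D : set T)
    (f : T -> R) : R :=
  fine (\esum_(x in D) ((EFin \o f)^\+ x)%E
        - \esum_(x in D) ((EFin \o f)^\- x)%E)%E.

Definition zeta (R : realType) (d : nat) (nu q : 'rV[nat]_d) : R :=
  abs_sum (perp_nz nu) (inv_monomial R q).

Definition zero_coord (d : nat) (k : 'I_d) (q : 'rV[nat]_d) : 'rV[nat]_d :=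
  \row_j (if j == k then 0%N else q ord0 j).

(* q - e_k; the subtraction is truncated, so this is meant for 0 < q_k. *)
Definition decr_coord (d : nat) (k : 'I_d) (q : 'rV[nat]_d) : 'rV[nat]_d :=
  \row_j (q ord0 j - (j == k))%N.

Definition Z_dom (d : nat) (k : 'I_d) (nu : 'rV[nat]_d) : set 'rV[int]_d :=
  [set n | perp nu n /\ n ord0 k = 0].

Definition Z_term (R : realType) (d : nat) (k : 'I_d) (q : 'rV[nat]_d) :
    'rV[int]_d -> R :=
  inv_monomial R (zero_coord k q).

Definition Z_series (R : realType) (d : nat) (k : 'I_d)
    (nu q : 'rV[nat]_d) : R :=
  abs_sum (Z_dom k nu) (Z_term R k q).

(* General term of the combined series \sum_(k : q_k = 1) nu_k Y_k: the series
   Y_k need not converge individually. *)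
Definition Y_term (R : realType) (d : nat) (nu q : 'rV[nat]_d)
    (n : 'rV[int]_d) : R :=
  \sum_(k < d | q ord0 k == 1%N)
    (nu ord0 k)%:R * inv_monomial R (zero_coord k q) n.

Definition Y_series (R : realType) (d : nat) (nu q : 'rV[nat]_d) : R :=
  abs_sum (perp_nz nu) (Y_term R nu q).

(* Main.v *)
(** Let [n] in the hyperplane have nonzero entries, let [d = m + 1], and let
[M] be the index of an entry of largest absolute value.  Since [1 / |n_M|] is at
most the product over [j <> M] of the weights [w (|n_j|)], with
[w x ~ x ^ (-1 / (m + 1))], the term [prod_j 1 / |n_j|] is bounded by
[prod_(j <> M) w (|n_j|) / |n_j|].  As [n] is determined by the entries other
than [n_M], the series is bounded by [sum_M (sum_(x <> 0) w (|x|) / |x|) ^ m],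
which is finite.  The series [Z_k] is then a reindexing, since a term of [Z_k]
with another zero entry vanishes, and the relation between the [Y_k] is the
equation [sum_k nu_k n_k = 0] divided by [n^q] and summed. *)

Require Import Defs.
From mathcomp Require Import finmap ring lra.
Import Order.TTheory GRing.Theory Num.Theory.
Set Implicit Arguments.
Unset Strict Implicit.
Unset Printing Implicit Defensive.

Local Open Scope classical_set_scope.
Local Open Scope ring_scope.

(** * Linearity and support of absolutely convergent sums *)

Section AbsSum.
Variables (R : realType) (T : choiceType).
Implicit Types (D E : set T) (f g : T -> R).

Lemma eq_abs_summable D f g : (forall x, D x -> f x = g x) ->
  abs_summable D f = abs_summable D g.
Proof.
by move=> fg; congr (_ < _)%E; apply: eq_esum => x Dx; rewrite /= fg.
Qed.

Lemma eq_abs_sum D f g : (forall x, D x -> f x = g x) ->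
  abs_sum D f = abs_sum D g.
Proof.
by move=> fg; congr (fine (_ - _)%E); apply: eq_esum => x Dx;
  rewrite ?funeposE ?funenegE /= fg.
Qed.

Lemma abs_summable0 D : abs_summable D (fun=> 0 : R).
Proof.
by rewrite /abs_summable /summable esum1 // => x _ /=; rewrite normr0.
Qed.

Lemma abs_sum0 D : abs_sum D (fun=> 0 : R) = 0.
Proof.
rewrite /abs_sum !esum1 ?subee // => x _; rewrite ?funeposE ?funenegE /= ?oppr0;
  by rewrite maxxx.
Qed.

Lemma abs_summableD D f g : abs_summable D f -> abs_summable D g ->
  abs_summable D (fun x => f x + g x).
Proof. exact: summableD. Qed.

Lemma abs_summableN D f : abs_summable D f -> abs_summable D (fun x => - f x).
Proof. by rewrite /abs_summable summableN. Qed.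

Lemma fin_num_esum_ge0 D (F : T -> \bar R) :
  (forall x, 0 <= F x)%E -> summable D F -> \esum_(x in D) F x \is a fin_num.
Proof.
move=> F0; rewrite summableE (eq_esum (b := F)) // => x _.
by rewrite gee0_abs.
Qed.

(** The splitting (f^+ + g^+) - (f^- + g^-) of f + g is in general not the one into positive and
    negative parts, but [esumB] accepts any difference of summable nonnegative families. *)
Lemma abs_sumD D f g : abs_summable D f -> abs_summable D g ->
  abs_sum D (fun x => f x + g x) = abs_sum D f + abs_sum D g.
Proof.
move=> Df Dg; pose F := EFin \o f; pose G := EFin \o g.
have F1 := summable_funepos Df; have F2 := summable_funeneg Df.
have G1 := summable_funepos Dg; have G2 := summable_funeneg Dg.
rewrite /abs_sum.
have -> : EFin \o (fun x => f x + g x) =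
    (F^\+ \+ G^\+ \- (F^\- \+ G^\-))%E.
  apply/funext => x; rewrite /= EFinD -[(f x)%:E]/(F x) -[(g x)%:E]/(G x).
  have FE (H : T -> \bar R) y : H y = (H^\+ y - H^\- y)%E.
    exact: (congr1 (@^~ y) (funeposneg H)).
  have Gn : (G^\- x)%E \is a fin_num by rewrite funenegE /G /= -EFin_max.
  rewrite (FE F x) (FE G x).
  by rewrite (fin_num_oppeD _ Gn) addeACA.
rewrite esumB; first last.
- by move=> x _; rewrite adde_ge0.
- by move=> x _; rewrite adde_ge0.
- exact: summableD.
- exact: summableD.
rewrite !esumD // -fineD; first last.
- by rewrite fin_numB !fin_num_esum_ge0.
- by rewrite fin_numB !fin_num_esum_ge0.
by rewrite fin_num_oppeD ?fin_num_esum_ge0 // addeACA.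
Qed.

Lemma abs_sumN D f : abs_summable D f ->
  abs_sum D (fun x => - f x) = - abs_sum D f.
Proof.
move=> Df; apply/eqP; rewrite -addr_eq0 -abs_sumD //; last exact: abs_summableN.
by rewrite (eq_abs_sum (g := fun=> 0)) ?abs_sum0 // => x _; rewrite addNr.
Qed.

Lemma abs_summableMn D f n :
  abs_summable D f -> abs_summable D (fun x => f x *+ n).
Proof.
move=> Df; elim: n => [|n IHn]; first exact: abs_summable0.
rewrite (eq_abs_summable (g := fun x => f x + f x *+ n)).
  exact: abs_summableD.
by move=> x _; rewrite mulrS.
Qed.

Lemma abs_sumMn D f n :
  abs_summable D f -> abs_sum D (fun x => f x *+ n) = abs_sum D f *+ n.
Proof.
move=> Df; elim: n => [|n IHn]; first by rewrite mulr0n -[RHS](abs_sum0 D).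
rewrite (eq_abs_sum (g := fun x => f x + f x *+ n)).
  by rewrite abs_sumD ?IHn ?mulrS //; apply: abs_summableMn.
by move=> x _; rewrite mulrS.
Qed.

(** Both claims go through one induction, since additivity at each step needs the tail to be
    summable. *)
Lemma abs_sum_sum D (I : Type) (s : seq I) (P : pred I) (F : I -> T -> R) :
  (forall i, P i -> abs_summable D (F i)) ->
  abs_summable D (fun x => \sum_(i <- s | P i) F i x) /\
  abs_sum D (fun x => \sum_(i <- s | P i) F i x) =
    \sum_(i <- s | P i) abs_sum D (F i).
Proof.
move=> DF; elim: s => [|i s [IH1 IH2]].
  rewrite big_nil (eq_abs_summable (g := fun=> 0)); last first.
    by move=> x _; rewrite big_nil.
  rewrite (eq_abs_sum (g := fun=> 0)); last by move=> x _; rewrite big_nil.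
  by split; [exact: abs_summable0|exact: abs_sum0].
rewrite big_cons; case: ifP => Pi.
  have FE x : D x -> \sum_(j <- i :: s | P j) F j x =
      F i x + \sum_(j <- s | P j) F j x by rewrite big_cons Pi.
  rewrite (eq_abs_summable FE) (eq_abs_sum FE) abs_sumD -?IH2 //;
    last exact: DF.
  by split=> //; apply: abs_summableD => //; exact: DF.
have FE x : D x -> \sum_(j <- i :: s | P j) F j x =
    \sum_(j <- s | P j) F j x by rewrite big_cons Pi.
by rewrite (eq_abs_summable FE) (eq_abs_sum FE).
Qed.

Lemma esum_support D E (F : T -> \bar R) :
  E `<=` D -> (forall x, D x -> ~ E x -> F x = 0%E) ->
  \esum_(x in D) F x = \esum_(x in E) F x.
Proof.
move=> ED F0; rewrite -[in RHS](setIidr ED) esum_mkcondr.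
apply: eq_esum => x Dx.
by case: ifPn => //; rewrite notin_setE => /(F0 _ Dx).
Qed.

Lemma abs_summable_support D E f :
  E `<=` D -> (forall x, D x -> ~ E x -> f x = 0) ->
  abs_summable D f = abs_summable E f.
Proof.
move=> ED f0; rewrite /abs_summable /summable (esum_support ED) //.
by move=> x Dx Ex; rewrite /= f0 ?normr0.
Qed.

Lemma abs_sum_support D E f :
  E `<=` D -> (forall x, D x -> ~ E x -> f x = 0) ->
  abs_sum D f = abs_sum E f.
Proof.
move=> ED f0; rewrite /abs_sum !(esum_support ED) // => x Dx Ex;
  by rewrite ?funeposE ?funenegE /= f0 // ?oppr0 maxxx.
Qed.

End AbsSum.

(** * Change of variables along a bijection *)

Section Reindex.
Variables (R : realType) (T T' : choiceType) (D : set T) (E : set T').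
Variables (e : T -> T') (f : T' -> R).
Hypothesis e_bij : set_bij D E e.

Lemma reindex_abs_summable : abs_summable E f = abs_summable D (f \o e).
Proof. by rewrite /abs_summable /summable (reindex_esum D E e). Qed.

Lemma reindex_abs_sum : abs_sum E f = abs_sum D (f \o e).
Proof.
rewrite /abs_sum !(reindex_esum D E e) //.
by congr (fine (_ - _)%E); apply: eq_esum => x _;
  rewrite ?funeposE ?funenegE.
Qed.

End Reindex.

(** * Weights replacing a fractional power *)

Lemma bernoulli_sub (R : realDomainType) (x : R) n :
  0 <= x <= 1 -> 1 - n%:R * x <= (1 - x) ^+ n.
Proof.
case/andP=> x0 x1; elim: n => [|n IHn]; first by rewrite mul0r subr0.
rewrite exprS; apply: le_trans (ler_wpM2l _ IHn); last by rewrite subr_ge0.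
(* This is the excess of (1 - x)(1 - n x) over 1 - (n + 1) x. *)
have : 0 <= n%:R * x * x by rewrite !mulr_ge0.
by rewrite -natr1; nra.
Qed.

Section Weight.
Variables (R : realType) (m : nat).

(* A stand-in for [(n + 1) ^ (-1 / (m + 1))] without roots: the sum of
   [weight k / k.+1] telescopes, because [weight k / k.+2] is
   [m.+1 * (weight k - weight k.+1)]. *)
Definition weight (n : nat) : R :=
  \prod_(k < n) (1 - (m.+1%:R * k.+2%:R)^-1).

Let factor_bounds k : 0 <= (m.+1%:R * k.+2%:R : R)^-1 <= 1.
Proof.
by rewrite invr_ge0 mulr_ge0 //= invf_le1 ?mulr_gt0 // -natrM ler1n muln_gt0.
Qed.

Lemma weightS n : weight n.+1 = weight n * (1 - (m.+1%:R * n.+2%:R)^-1).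
Proof. by rewrite /weight big_ord_recr. Qed.

Lemma weight_ge0 n : 0 <= weight n.
Proof.
by apply: prodr_ge0 => k _; rewrite subr_ge0; case/andP: (factor_bounds k).
Qed.

Lemma weight_anti a b : (a <= b)%N -> weight b <= weight a.
Proof.
move=> /subnK <-; elim: (b - a)%N => [|n IHn] //.
rewrite addSn weightS (le_trans _ IHn) // ler_piMr ?weight_ge0 //.
Qed.

(** The left side is the product of the 1 - 1 / (k + 2) for k < n. By Bernoulli each factor is at
    most the m-th power of the factor of [weight], because m / (m + 1) <= 1. *)
Lemma inv_le_weightX n : n.+1%:R^-1 <= weight n ^+ m.
Proof.
elim: n => [|n IHn]; first by rewrite /weight big_ord0 expr1n invr1.
rewrite weightS exprMn.
have -> : n.+2%:R^-1 = n.+1%:R^-1 * (1 - n.+2%:R^-1) :> R.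
  have n1 : n.+1%:R != 0 :> R by rewrite pnatr_eq0.
  have : n.+2%:R != 0 :> R by rewrite pnatr_eq0.
  by rewrite -(natr1 n.+1) => n2; field; rewrite nat1r n1 n2.
apply: ler_pM => //; first by rewrite subr_ge0 invf_le1 ?ler1n.
apply: le_trans (bernoulli_sub _ (factor_bounds n)).
rewrite lerB // invfM mulrA ler_piMl // ler_pdivrMr // mul1r.
by rewrite ler_nat.
Qed.

Lemma weight_sum_le N :
  \sum_(k < N) weight k / k.+1%:R <= m.+2%:R.
Proof.
apply: (@le_trans _ _ (\sum_(k < N.+1) weight k / k.+1%:R)).
  rewrite big_ord_recr /= lerDl divr_ge0 ?weight_ge0 //.
(* The 1 is the term k = 0. For later terms, [weight k.+1 / k.+2] is at most [weight k / k.+2],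
   which telescopes. *)
apply: (@le_trans _ _ (1 + m.+1%:R * (1 - weight N))); last first.
  rewrite mulrBr mulr1 addrA nat1r gerBl mulr_ge0 ?weight_ge0 //.
elim: N => [|N IHN].
  rewrite big_ord_recr big_ord0 /= /weight big_ord0.
  by rewrite divr1 subrr mulr0 addr0 add0r.
rewrite big_ord_recr /=; apply: le_trans (lerD IHN (lexx _)) _.
apply: (@le_trans _ _ (1 + m.+1%:R * (1 - weight N) + weight N / N.+2%:R)).
  by rewrite lerD2l ler_wpM2r ?invr_ge0 // weight_anti.
rewrite weightS le_eqVlt; apply/orP; left; apply/eqP.
have n1 : m.+1%:R != 0 :> R by rewrite pnatr_eq0.
have n2 : N.+2%:R != 0 :> R by rewrite pnatr_eq0.
move: (weight N) (m.+1%:R) (N.+2%:R) n1 n2 => w x y x0 y0.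
by field; rewrite x0 y0.
Qed.

End Weight.

(** * Absolute convergence of the zeta series *)

Lemma sum_uniq_le (R : numDomainType) (T : finType) (s : seq T) (F : T -> R) :
  uniq s -> (forall x, 0 <= F x) -> \sum_(x <- s) F x <= \sum_x F x.
Proof.
move=> us F0; rewrite big_uniq // [leRHS](bigID (mem s)) /= lerDl.
exact: sumr_ge0.
Qed.

(** A nonzero integer is coded by its absolute value minus 1 and its sign. Extending the sum to all
    codes below a common bound makes it factor into d equal sums, each doubled by the two signs. *)
Lemma sum_prod_absz_le (R : realDomainType) d (G : nat -> R) (C : R)
    (B : seq 'rV[int]_d) :
  (forall k, 0 <= G k) -> (forall N, \sum_(k < N) G k <= C) ->
  uniq B -> (forall b, b \in B -> forall j, b ord0 j != 0) ->
  \sum_(b <- B) \prod_(j < d) G (`|b ord0 j|%N.-1) <= (C *+ 2) ^+ d.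
Proof.
move=> G0 GC uB B0.
pose N := (\max_(b <- B) \max_(j < d) `|b ord0 j|%N).
have BN b j : b \in B -> (`|b ord0 j|.-1 < N.+1)%N.
  move=> bB; rewrite ltnS (leq_trans (leq_pred _)) //.
  apply: leq_trans (leq_bigmax_seq _ bB erefl).
  exact: (leq_bigmax (F := fun j => `|b ord0 j|%N)).
pose code (b : 'rV[int]_d) : {ffun 'I_d -> 'I_N.+1 * bool} :=
  [ffun j => (inord `|b ord0 j|%N.-1, b ord0 j < 0)].
have code_inj : {in B &, injective code}.
  move=> a b aB bB /ffunP ab; apply/rowP => j; have := ab j; rewrite !ffunE.
  case=> /(congr1 val); rewrite /= !inordK ?BN // => abj sgn.
  (* Nonzero entries matter: [.-1] sends the absolute values 0 and 1 both to 0. *)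
  have := B0 _ aB j; have := B0 _ bB j.
  by move: abj sgn; move: (a _ _) (b _ _) => [[|x]|x] [[|y]|y] //= -> //.
pose F (c : {ffun 'I_d -> 'I_N.+1 * bool}) := \prod_j G (c j).1.
rewrite (eq_big_seq (F \o code)); last first.
  by move=> b bB; apply: eq_bigr => j _; rewrite ffunE /= inordK ?BN.
rewrite -[leLHS](big_map code xpredT F).
apply: le_trans (sum_uniq_le _ _) _; first by rewrite map_inj_in_uniq.
  by move=> c; apply: prodr_ge0.
rewrite -(bigA_distr_bigA (fun _ (u : 'I_N.+1 * bool) => G u.1)).
rewrite prodr_const card_ord.
apply: lerXn2r; rewrite ?nnegrE ?sumr_ge0 //.
  by rewrite mulrn_wge0 // (le_trans _ (GC 0%N)) // big_ord0.
rewrite -(pair_bigA _ (fun (i : 'I_N.+1) (_ : bool) => G i)) /=.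
under eq_bigr do rewrite sumr_const card_bool.
by rewrite sumrMnl lerMn2r GC orbT.
Qed.

Lemma prod_inv_le_weight (R : realType) m (n : 'rV[int]_m.+1) :
  (forall j, n ord0 j != 0) -> exists M : 'I_m.+1,
  \prod_(j < m.+1) (`|n ord0 j|%N%:R : R)^-1 <=
  \prod_(j < m) (weight R m `|col' M n ord0 j|%N.-1 /
                   `|col' M n ord0 j|%N.-1.+1%:R).
Proof.
move=> n0; have [M _ Mmax] := @arg_maxnP _ (ord0 : 'I_m.+1) xpredT
  (fun j => `|n ord0 j|%N) isT.
exists M; rewrite (bigD1_ord M) //= big_split /=.
have npos j : (0 < `|n ord0 j|)%N by rewrite absz_gt0.
apply: ler_pM; rewrite ?invr_ge0 ?prodr_ge0 //; last first.
  by rewrite le_eqVlt; apply/orP; left; apply/eqP/eq_bigr => j _;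
     rewrite mxE prednK.
(* The m-th power supplies one weight for each of the m other entries; these are no larger in
   absolute value, so their own weights are at least as big. *)
apply: (@le_trans _ _ (\prod_(j < m) weight R m `|n ord0 M|%N.-1)).
  by rewrite prodr_const card_ord -{1}(prednK (npos M)) inv_le_weightX.
apply: ler_prod => j _.
rewrite weight_ge0 /= weight_anti // mxE -ltnS !prednK //; exact: Mmax.
Qed.

(** As nu_M is nonzero, the linear equation can be solved for the entry at [M]. *)
Lemma perp_col'_inj m (nu : 'rV[nat]_m.+1) M (a b : 'rV[int]_m.+1) :
  (0 < nu ord0 M)%N -> perp nu a -> perp nu b -> col' M a = col' M b -> a = b.
Proof.
rewrite /perp /= => nuM pa pb /rowP ab.
have abl j : a ord0 (lift M j) = b ord0 (lift M j).
  by have := ab j; rewrite !mxE.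
have abM : a ord0 M = b ord0 M.
  have nu0 : (nu ord0 M)%:Z != 0 by rewrite eqz_nat -lt0n.
  apply: (mulfI nu0); have := etrans pa (esym pb).
  rewrite (bigD1_ord M) //= [RHS](bigD1_ord M) //=.
  by under eq_bigr do rewrite abl; apply: addIr.
by apply/rowP => j; case: (unliftP M j) => [i ->|->].
Qed.

Lemma norm_inv_monomial_le (R : realType) d (q : 'rV[nat]_d) (n : 'rV[int]_d) :
  (forall j, (0 < q ord0 j)%N) -> (forall j, n ord0 j != 0) ->
  `|inv_monomial R q n| <= \prod_(j < d) (`|n ord0 j|%N%:R)^-1.
Proof.
move=> q0 n0; rewrite normr_prod; apply: ler_prod => j _.
rewrite normr_ge0 normfV normrX -intr_norm -natr_absz.
have n1 : 1 <= `|n ord0 j|%N%:R :> R by rewrite ler1n absz_gt0.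
rewrite lef_pV2 ?posrE ?exprn_gt0 ?(lt_le_trans ltr01) //.
by rewrite -[leLHS]expr1 ler_weXn2l.
Qed.

Lemma summable_inv_monomial (R : realType) m (nu q : 'rV[nat]_m.+1) :
  (forall j, (0 < nu ord0 j)%N) -> (forall j, (0 < q ord0 j)%N) ->
  abs_summable (perp_nz nu) (inv_monomial R q).
Proof.
(* There are m + 1 choices of [M]; each contributes m doubled one-variable sums, bounded by m + 2 in
   [weight_sum_le]. *)
move=> nu0 q0; pose C : R := ((m.+2%:R *+ 2) ^+ m) *+ m.+1.
apply: (@le_lt_trans _ _ C%:E); last exact: ltry.
apply: ge_ereal_sup => _ [A [finA AD] <-].
have {}AD n : n \in fset_set A -> perp_nz nu n.
  by rewrite in_fset_set // => /set_mem /AD.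
rewrite fsbig_finite //= sumEFin lee_fin.
pose F M (n : 'rV[int]_m.+1) := \prod_(j < m)
  (weight R m `|col' M n ord0 j|%N.-1 / `|col' M n ord0 j|%N.-1.+1%:R).
have F0 M n : 0 <= F M n.
  by apply: prodr_ge0 => j _; rewrite divr_ge0 ?weight_ge0.
(* The index [M] depends on [n]; summing over all [M] removes this dependence. *)
apply: (@le_trans _ _ (\sum_(n <- fset_set A) \sum_M F M n)).
  rewrite big_seq [leRHS]big_seq; apply: ler_sum => n /AD [_ n0].
  apply: le_trans (norm_inv_monomial_le _ q0 n0) _.
  have [M /le_trans] := prod_inv_le_weight R n0; apply.
  by rewrite (bigD1 M) //= lerDl sumr_ge0.
rewrite exchange_big /=.
apply: (@le_trans _ _ (\sum_(M < m.+1) (m.+2%:R *+ 2) ^+ m)); last first.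
  by rewrite sumr_const card_ord.
apply: ler_sum => M _.
rewrite -[leLHS](big_map (col' M) xpredT (fun b : 'rV[int]_m =>
  \prod_(j < m) (weight R m `|b ord0 j|%N.-1 / `|b ord0 j|%N.-1.+1%:R))).
apply: (@sum_prod_absz_le _ _ (fun k => weight R m k / k.+1%:R)).
- by move=> k; rewrite divr_ge0 ?weight_ge0.
- exact: weight_sum_le.
- rewrite map_inj_in_uniq ?fset_uniq // => a b /AD [pa _] /AD [pb _].
  exact: perp_col'_inj pa pb.
- by move=> _ /mapP [n /AD [_ n0] ->] j; rewrite mxE.
Qed.

(** * Reduction of Z_k to a zeta series in one dimension less *)

Definition insert0 r (k : 'I_r.+1) (n : 'rV[int]_r) : 'rV[int]_r.+1 :=
  \row_j (if unlift k j is Some i then n ord0 i else 0).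

Lemma insert0_lift r (k : 'I_r.+1) n i : insert0 k n ord0 (lift k i) = n ord0 i.
Proof. by rewrite mxE liftK. Qed.

Lemma insert0_at r (k : 'I_r.+1) n : insert0 k n ord0 k = 0.
Proof. by rewrite mxE unlift_none. Qed.

Lemma perp_insert0 r (k : 'I_r.+1) (nu : 'rV[nat]_r.+1) n :
  perp nu (insert0 k n) = perp (col' k nu) n.
Proof.
rewrite /perp /= (bigD1_ord k) //= insert0_at mulr0 add0r.
by congr (_ = 0); apply: eq_bigr => i _; rewrite insert0_lift mxE.
Qed.

Lemma Z_term_insert0 (R : realType) r (k : 'I_r.+1) (q : 'rV[nat]_r.+1) n :
  Z_term R k q (insert0 k n) = inv_monomial R (col' k q) n.
Proof.
rewrite /Z_term /inv_monomial (bigD1_ord k) //= insert0_at.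
(* The factor at [k] is 0 ^- 0 = 1. *)
rewrite [zero_coord k q ord0 k]mxE eqxx expr0 invr1 mul1r.
apply: eq_bigr => i _; rewrite insert0_lift !mxE.
by rewrite [lift k i == k]eq_sym (negPf (neq_lift k i)).
Qed.

(** The points of [Z_dom k nu] with another zero entry are left out; by [Z_term_eq0] they contribute
    nothing. *)
Lemma insert0_bij r (k : 'I_r.+1) (nu : 'rV[nat]_r.+1) :
  set_bij (perp_nz (col' k nu))
    (Z_dom k nu `&` [set n | forall i, n ord0 (lift k i) != 0]) (insert0 k).
Proof.
split.
- move=> n [pn n0]; split; first by split; rewrite ?perp_insert0 ?insert0_at.
  by move=> i; rewrite insert0_lift.
- move=> a b _ _ ab; apply/rowP => i.
  by have /rowP/(_ (lift k i)) := ab; rewrite !insert0_lift.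
- move=> n [[pn nk] n0].
  have E : insert0 k (col' k n) = n.
    apply/rowP => j; case: (unliftP k j) => [i ->|->].
      by rewrite insert0_lift mxE.
    by rewrite insert0_at nk.
  exists (col' k n) => //; split; first by rewrite -perp_insert0 E.
  by move=> i; rewrite mxE.
Qed.

(** A zero entry away from [k] keeps its positive exponent, and 0 ^- m = 0 for m >= 1. *)
Lemma Z_term_eq0 (R : realType) r (k : 'I_r.+1) (q : 'rV[nat]_r.+1)
    (n : 'rV[int]_r.+1) :
  (forall j, (0 < q ord0 j)%N) ->
  ~ (forall i, n ord0 (lift k i) != 0) -> Z_term R k q n = 0.
Proof.
move=> q0 /existsNP [i /negP]; rewrite negbK => /eqP ni0.
apply/eqP/prodf_eq0; exists (lift k i) => //.
rewrite mxE [lift k i == k]eq_sym (negPf (neq_lift k i)) ni0.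
by rewrite invr_eq0 expr0n -[q _ _ == 0%N]negbK -lt0n q0.
Qed.

(** * The relation between the Y_k *)

Lemma inv_monomial_decr (R : realType) d (k : 'I_d) (q : 'rV[nat]_d)
    (n : 'rV[int]_d) :
  (0 < q ord0 k)%N -> n ord0 k != 0 ->
  inv_monomial R (decr_coord k q) n = (n ord0 k)%:~R * inv_monomial R q n.
Proof.
move=> qk nk; rewrite /inv_monomial (bigD1 k) //= [in RHS](bigD1 k) //= mulrA.
congr (_ * _); last first.
  by apply: eq_bigr => j /negPf jk; rewrite mxE jk subn0.
rewrite mxE eqxx subn1 -[in RHS](prednK qk) exprS invfM mulVKf //.
by rewrite intr_eq0.
Qed.

(** Brings the terms of Y_k into the form n_k / n^q shared by the other side of the relation. *)
Lemma zero_coord_decr d (k : 'I_d) (q : 'rV[nat]_d) :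
  q ord0 k = 1%N -> zero_coord k q = decr_coord k q.
Proof.
move=> qk; apply/rowP => j; rewrite !mxE.
by case: eqP => [->|_]; rewrite ?qk ?subn0.
Qed.

(* Dividing [\sum_k nu_k n_k = 0] by [n^q] splits the terms according to
   whether [q_k] is 1 or larger. *)
Lemma Y_termE (R : realType) d (nu q : 'rV[nat]_d) (n : 'rV[int]_d) :
  (forall j, (0 < q ord0 j)%N) -> perp_nz nu n ->
  Y_term R nu q n = - \sum_(k < d | (1 < q ord0 k)%N)
    inv_monomial R (decr_coord k q) n *+ nu ord0 k.
Proof.
move=> q0 [pn n0]; apply/eqP; rewrite -addr_eq0; apply/eqP.
have := congr1 (fun z : int => z%:~R * inv_monomial R q n) pn.
rewrite mul0r rmorph_sum mulr_suml /= => nuq; rewrite -[RHS]nuq.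
rewrite [RHS](bigID (fun k => q ord0 k == 1%N)) /=; congr (_ + _).
  apply: eq_bigr => k /eqP qk.
  by rewrite zero_coord_decr // inv_monomial_decr // intrM mulrA.
apply: eq_big => k; first by rewrite ltn_neqAle q0 andbT eq_sym.
by move=> qk; rewrite inv_monomial_decr // intrM -mulrA -mulr_natl.
Qed.

Theorem theorem4p1 (R : realType) (r : nat) (nu q : 'rV[nat]_r.+1)
    (r_ge1 : (1 <= r)%N)
    (nu_pos : forall j : 'I_r.+1, (0 < nu ord0 j)%N)
    (nu_distinct : forall i j : 'I_r.+1, i != j -> nu ord0 i != nu ord0 j)
    (nu_coprime : forall i j : 'I_r.+1,
      i != j -> coprime (nu ord0 i) (nu ord0 j))
    (q_pos : forall j : 'I_r.+1, (0 < q ord0 j)%N) :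
  [/\ abs_summable (perp_nz nu) (inv_monomial R q),
      forall k : 'I_r.+1,
        abs_summable (Z_dom k nu) (Z_term R k q) /\
        Z_series R k nu q = zeta R (col' k nu) (col' k q),
      abs_summable (perp_nz nu) (Y_term R nu q) &
      Y_series R nu q =
        - \sum_(k < r.+1 | (1 < q ord0 k)%N)
            (nu ord0 k)%:R * zeta R nu (decr_coord k q)].
Proof.
(* Since q_k > 1, the entries of q - e_k are still positive. *)
have decr_summable k : (1 < q ord0 k)%N ->
    abs_summable (perp_nz nu) (inv_monomial R (decr_coord k q)).
  move=> qk; apply: summable_inv_monomial => // j.
  by rewrite mxE; case: eqP => [->|_]; rewrite ?subn1 ?subn0 // -ltnS prednK.
have [Ysummable Ysum] := @abs_sum_sum R _ (perp_nz nu) _ (index_enum 'I_r.+1)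
  (fun k => 1 < q ord0 k)%N
  (fun k n => inv_monomial R (decr_coord k q) n *+ nu ord0 k)
  (fun k qk => abs_summableMn _ (decr_summable k qk)).
split.
- exact: summable_inv_monomial.
- move=> k; have Z0 x : Z_dom k nu x ->
      ~ (Z_dom k nu `&` [set n | forall i, n ord0 (lift k i) != 0]) x ->
      Z_term R k q x = 0.
    by move=> Zx nx; apply: Z_term_eq0 => // x0; apply: nx.
  have ZE x : perp_nz (col' k nu) x ->
      (Z_term R k q \o insert0 k) x = inv_monomial R (col' k q) x.
    by move=> _; exact: Z_term_insert0.
  rewrite /Z_series (abs_sum_support _ Z0); last exact: subIsetl.
  rewrite (abs_summable_support _ Z0); last exact: subIsetl.
  rewrite (reindex_abs_summable _ (insert0_bij k nu)).
  rewrite (reindex_abs_sum _ (insert0_bij k nu)).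
  rewrite (eq_abs_summable ZE) (eq_abs_sum ZE); split => //.
  clear nu_distinct nu_coprime decr_summable Ysummable Ysum Z0 ZE.
  (* As r >= 1, the vectors with entry [k] deleted have positive length m + 1, the form
     [summable_inv_monomial] takes. *)
  case: r r_ge1 nu q nu_pos q_pos k => // m _ nu' q' nu0 q0 k.
  by apply: summable_inv_monomial => j; rewrite mxE.
(* Termwise the combined series is a finite combination of zeta terms, so no convergence of a single
   Y_k is involved. *)
- rewrite (eq_abs_summable (fun n Dn => Y_termE R q_pos Dn)).
  exact: abs_summableN.
- rewrite /Y_series (eq_abs_sum (fun n Dn => Y_termE R q_pos Dn)).
  rewrite abs_sumN // Ysum; congr (- _); apply: eq_bigr => k qk.
  by rewrite abs_sumMn ?mulr_natl //; exact: decr_summable.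
Qed.
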